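(* Let $\mathbb{K}$ be a field and let $I\subset S=\mathbb{K}[x_1,\ldots,x_n]$ be a nonzero proper squarefree monomial ideal. The asymptotic resurgence of $I$ is equal to the maximum of its skew resurgences; that is, $$\rho_a(I)=\sup\{v_a(I): v\text{ is a skew valuation supported on } I\}.$$
   Context: For a squarefree monomial ideal, $I^{(s)}=\bigcap_{P\in\mathrm{Ass}(I)}P^s$. The asymptotic resurgence is $\rho_a(I)=\sup\{\frac{s}{r}: s,r\text{ positive integers},\ I^{(st)}\not\subset I^{rt}\text{ for all } t\gg 0\}$. For $\mathbf{v}=(e_1,\ldots,e_n)\in\mathbb{Z}_{\ge 0}^n$ write $\mathbf{x}^{\mathbf{v}}=\prod x_i^{e_i}$. A skew valuation is a linear functional $v:\mathbb{R}^n\to\mathbb{R}$ that is positive semidefinite, i.e. nonnegative on the first orthant. For a nonzero monomial ideal $J$, $v(J)=\min\{v(\mathbf{v}):\mathbf{x}^{\mathbf{v}}\in J\}$. The skew valuation $v$ is supported on $I$ if $v(I)>0$. The skew Waldschmidt constant is $\widehat{v}(I)=\lim_{s\to\infty}\frac{v(I^{(s)})}{s}$ (the limit exists, and is positive if $v$ is supported on $I$). If $v$ is supported on $I$, the skew resurgence of $I$ with respect to $v$ is $v_a(I)=\frac{v(I)}{\widehat{v}(I)}$. *)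

(* Defs.v *)
From HB Require Import structures.
From mathcomp Require Import all_boot all_order all_algebra.
From mathcomp Require Import boolp classical_sets reals ereal topology
  normedtype sequences.
(* The notations of mpoly clash with those of mathcomp-analysis. *)
From mathcomp Require Import -(notations) mpoly.

Set Implicit Arguments.
Unset Strict Implicit.
Unset Printing Implicit Defensive.

Import Order.TTheory GRing.Theory Num.Theory.
Import numFieldNormedType.Exports.

Local Open Scope classical_set_scope.
Local Open Scope ring_scope.

Section Ideals.
Variable A : comNzRingType.
Implicit Types (I P J : set A).

(* The unit ideal is allowed, unlike in idealr_closed. *)
Definition is_ideal I : Prop :=
  I 0 /\ forall a x y, I x -> I y -> I (a * x + y).

Definition ideal_gen (G : set A) : set A := smallest is_ideal G.

(* The 0-th power is the unit ideal, the empty product being 1. *)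
Definition ideal_pow I (s : nat) : set A :=
  ideal_gen [set x | exists2 f : 'I_s -> A,
                       forall i, I (f i) & x = \prod_(i < s) f i].

Definition prime_ideal P : Prop :=
  idealr_closed [in P] /\ prime_idealr_closed [in P].

(* P is prime and is the annihilator (I : f) of the class of some f in A/I. *)
Definition Ass I : set (set A) :=
  [set P | prime_ideal P /\ exists f, P = [set g | I (g * f)]].

Definition symbolic_pow I (s : nat) : set A :=
  \bigcap_(P in Ass I) ideal_pow P s.

End Ideals.

Definition asymptotic_resurgence (R : realType) (A : comNzRingType)
    (I : set A) : \bar R :=
  ereal_sup [set x | exists s r : nat,
    [/\ (0 < s)%N, (0 < r)%N,
        \forall t \near \oo,
          ~ (symbolic_pow I (s * t) `<=` ideal_pow I (r * t))
      & x = (s%:R / r%:R)%:E]].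

Section Monomial.
Variables (K : fieldType) (n : nat).

Notation S := (mpoly n K).
Notation exponent := (multinom n).

Definition monomial (m : exponent) : S := mpolyX K m.

Definition squarefree (m : exponent) : Prop :=
  forall i : 'I_n, (m i <= 1)%N.

Definition squarefree_monomial_ideal (I : set S) : Prop :=
  exists2 G : set exponent,
    G `<=` squarefree & I = ideal_gen (monomial @` G).

Section SkewValuation.
Variable R : realType.
Implicit Types (v : {scalar 'rV[R]_n}) (I J : set S).

Definition skew_valuation v : Prop :=
  forall x : 'rV[R]_n, (forall i, 0 <= x 0 i) -> 0 <= v x.

Definition exponent_vector (m : exponent) : 'rV[R]_n :=
  \row_i (m i)%:R.

(* For a skew valuation v and a nonzero monomial ideal J the infimum is a
   minimum: by Dickson's lemma J has finitely many minimal monomials. *)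
Definition val_ideal v J : R :=
  inf [set v (exponent_vector m) | m in [set m | J (monomial m)]].

Definition supported v I : Prop := 0 < val_ideal v I.

Definition skew_waldschmidt v I : R :=
  limn (fun s : nat => val_ideal v (symbolic_pow I s) / s%:R).

Definition skew_resurgence v I : R := val_ideal v I / skew_waldschmidt v I.

Definition skew_resurgences I : set (\bar R) :=
  [set (skew_resurgence v I)%:E
     | v in [set v : {scalar 'rV[R]_n} | skew_valuation v /\ supported v I]].

End SkewValuation.
End Monomial.

Arguments asymptotic_resurgence R [A] I.
Arguments skew_resurgences [K n] R I.

(* Main.v *)
Require Import Defs.
From HB Require Import structures.
From mathcomp Require Import all_boot all_order all_algebra.
From mathcomp Require Import boolp classical_sets reals ereal topology
  normedtype sequences derive.
From mathcomp Require Import -(notations) mpoly.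

(** Both sides are computed by a linear program. Let the edges be the sets [A]
    of variables whose product lies in [I], and the covers the sets [C] meeting
    every edge. The variables in a minimal cover generate an associated prime,
    and every associated prime contains the variables of some cover;
    hence a monomial of exponent [m] lies in the [s]-th symbolic power exactly
    when [m] has weight at least [s] on every cover. In other words [m / s]
    lies in the symbolic polyhedron, cut out by [x >= 0] and [x(C) >= 1] for
    all covers [C], and rounding up shows that the skew Waldschmidt constant of
    a valuation [v] is its infimum over this polyhedron ([skew_waldschmidtE]).

    Each skew resurgence is a lower bound for the asymptotic one: if [s / r] is
    below [v(I)] divided by the skew Waldschmidt constant, then for large [t]
    some monomial of the [s t]-th symbolic power has [v]-value below
    [r t v(I)], too small for the [r t]-th ordinary power
    ([skew_obstruction]).

    For the converse, consider the weights [w >= 0] with [w(A) >= 1] on every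
    edge, and minimize the pairing of [w] and [x] over all such [w] and all [x]
    in the symbolic polyhedron. Capping coordinates at 1 makes this a problem
    on a compact set, so the minimum [mu] is attained, at [w] and [x] say
    ([pairing_min_attained]). As a valuation, [w] is at least 1 on [I] and its
    skew Waldschmidt constant is at most [mu], so its skew resurgence is at
    least [1 / mu]. On the other hand every point of the symbolic polyhedron
    dominates a fractional packing of edges of total weight [mu], by linear
    programming duality ([fractional_packing], from [farkas]). For a monomial
    in the [s t]-th symbolic power, scaling the packing by [s t] and rounding
    down writes it as a multiple of at least [s t mu - constant] edges; if
    [s mu > r] this exceeds [r t] for large [t], and containment holds
    ([symbolic_sub_ideal_pow]). Thus the asymptotic resurgence is at most
    [1 / mu], and the skew resurgence of [w] attains it. *)

Set Implicit Arguments.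
Unset Strict Implicit.
Unset Printing Implicit Defensive.

Import Order.TTheory GRing.Theory Num.Theory.
Import numFieldNormedType.Exports.

Local Open Scope classical_set_scope.
Local Open Scope ring_scope.

(** * Ideals and their powers *)

Section Ideals.
Variable A : comNzRingType.
Implicit Types (I J : set A).

Lemma ideal_gen_is_ideal (G : set A) : is_ideal (ideal_gen G).
Proof.
split=> [|a x y Gx Gy] M [Mi GM]; first exact: Mi.1.
by apply: Mi.2; [apply: Gx | apply: Gy].
Qed.

Lemma subset_ideal_gen (G : set A) : G `<=` ideal_gen G.
Proof. by move=> x Gx M [_]; apply. Qed.

Lemma ideal_gen_min (G J : set A) : is_ideal J -> G `<=` J -> ideal_gen G `<=` J.
Proof. by move=> iJ GJ x; apply. Qed.

Lemma idealMl I a x : is_ideal I -> I x -> I (a * x).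
Proof. by move=> [I0 Iax] Ix; rewrite -[_ * _]addr0; apply: Iax. Qed.

Lemma idealD I x y : is_ideal I -> I x -> I y -> I (x + y).
Proof. by move=> [_ Iax] Ix Iy; rewrite -[x]mul1r; apply: Iax. Qed.

Lemma ideal_sum I (T : Type) (l : seq T) (P : pred T) (F : T -> A) :
  is_ideal I -> (forall t, P t -> I (F t)) -> I (\sum_(t <- l | P t) F t).
Proof.
move=> iI IF; apply: (big_ind I) => //; first exact: iI.1.
by move=> x y; apply: idealD.
Qed.

Lemma ideal_sum_seq I (T : eqType) (l : seq T) (F : T -> A) :
  is_ideal I -> (forall t, t \in l -> I (F t)) -> I (\sum_(t <- l) F t).
Proof. by move=> iI IF; rewrite big_seq; apply: ideal_sum. Qed.

Lemma ideal_pow_is_ideal I k : is_ideal (ideal_pow I k).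
Proof. exact: ideal_gen_is_ideal. Qed.

Lemma prod_seq_ideal_pow I (l : seq A) k :
  {in l, forall x, I x} -> (k <= size l)%N -> ideal_pow I k (\prod_(x <- l) x).
Proof.
move=> Il kl; rewrite -(cat_take_drop k l) big_cat /= mulrC.
apply: (@idealMl (ideal_pow I k)); first exact: ideal_pow_is_ideal.
apply: subset_ideal_gen; exists (fun i : 'I_k => nth 0 l i) => [i|].
  by apply: Il; rewrite mem_nth// (leq_trans (ltn_ord i)).
rewrite (big_nth 0) size_takel// big_mkord; apply: eq_bigr => i _.
by rewrite nth_take.
Qed.

(** The exponents are allowed to sum to more than [k], so that a monomial
    dominating a product of [k] generators is covered without truncating. *)
Lemma prod_exp_ideal_pow I (T : finType) (P : pred T) (g : T -> A)
    (c : T -> nat) k :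
  (forall t, P t -> I (g t)) -> (k <= \sum_(t | P t) c t)%N ->
  ideal_pow I k (\prod_(t | P t) g t ^+ c t).
Proof.
move=> Ig kc.
pose l := flatten [seq nseq (c t) (g t) | t <- enum P].
have -> : \prod_(t | P t) g t ^+ c t = \prod_(x <- l) x.
  rewrite big_flatten big_map big_enum/=; apply: eq_bigr => t _.
  by rewrite big_nseq -Monoid.iteropE.
apply: prod_seq_ideal_pow.
  move=> x /flattenP[s /mapP[t + ->] /nseqP[-> _]].
  by rewrite mem_enum => Pt; apply: Ig.
rewrite size_flatten /shape -map_comp sumnE big_map big_enum/=.
by under eq_bigr do rewrite /= size_nseq.
Qed.

End Ideals.

(** * Polynomials whose monomials all have large weight *)

Section Weights.
Variables (K : fieldType) (n : nat) (R : realDomainType).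
Variable w : multinom n -> R.
Hypothesis wD : forall m1 m2, w (mnm_add m1 m2) = w m1 + w m2.
Hypothesis w_ge0 : forall m, 0 <= w m.
Implicit Types (g : mpoly n K) (J : set (mpoly n K)).

(** For the weight counting variables of [C] this is a power of a monomial
    prime; for the weight given by a skew valuation it contains the powers of
    any ideal on which the valuation is bounded below. *)
Definition weight_ge (c : R) : set (mpoly n K) :=
  [set g | forall m, m \in msupp g -> c <= w m].

Lemma weight_geM b c g h :
  weight_ge b g -> weight_ge c h -> weight_ge (b + c) (g * h).
Proof.
move=> gb hc m /msuppM_le/allpairsP[[m1 m2] /= [m1g m2h ->]].
by rewrite wD lerD ?gb ?hc.
Qed.

Lemma weight_ge_is_ideal c : is_ideal (weight_ge c).
Proof.
split=> [m|a g h gc hc m]; first by rewrite msupp0.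
move=> /msuppD_le; rewrite mem_cat => /orP[|/hc//].
have: weight_ge (0 + c) (a * g) by apply: weight_geM => // m' _.
by rewrite add0r; apply.
Qed.

Lemma ideal_pow_weight_ge J c k :
  J `<=` weight_ge c -> ideal_pow J k `<=` weight_ge (c *+ k).
Proof.
move=> Jc; apply: ideal_gen_min; first exact: weight_ge_is_ideal.
move=> _ [f Jf ->]; rewrite -[k in c *+ k]card_ord -sumr_const.
elim/big_ind2: _ => [m| | i _]; last exact/Jc/Jf.
- by rewrite msupp1 inE => /eqP ->.
- by move=> x1 c1 x2 c2; apply: weight_geM.
Qed.

End Weights.

(** * Monomials of symbolic and ordinary powers *)

Section Monomials.
Variables (K : fieldType) (n : nat).
Implicit Types (I J P : set (mpoly n K)) (m : multinom n) (A C : {set 'I_n}).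
Local Notation xset A := (monomial K (mesym1 A)).

Lemma ideal_monomial_le I m1 m2 : is_ideal I -> (forall i, m1 i <= m2 i)%N ->
  I (monomial K m1) -> I (monomial K m2).
Proof.
move=> iI le12 Im1.
have -> : m2 = mnm_add (mnm_sub m2 m1) m1.
  by apply/mnmP => i; rewrite mnmDE mnmBE subnK.
by rewrite /monomial mpolyXD; apply: idealMl.
Qed.

Lemma ideal_supp_monomial I g : is_ideal I ->
  (forall m, m \in msupp g -> I (monomial K m)) -> I g.
Proof.
move=> iI Im; rewrite (mpolyE g); apply: ideal_sum_seq => // m /Im Xm.
by rewrite -mul_mpolyC; apply: idealMl.
Qed.

Definition mvars m : {set 'I_n} := [set i | m i != 0%N]%SET.

Lemma mesym1_mem A i : mesym1 A i = (i \in A).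
Proof. exact: mnmE. Qed.

(** For a monomial ideal this is squarefreeness, expressed without generators. *)
Definition supports_closed I : Prop :=
  forall g m, I g -> m \in msupp g -> I (xset (mvars m)).

Lemma squarefree_is_ideal I : squarefree_monomial_ideal I -> is_ideal I.
Proof. by case=> G _ ->; apply: ideal_gen_is_ideal. Qed.

(** Multiplying by a polynomial only enlarges the sets of variables occurring in
    monomials, so the polynomials satisfying the conclusion form an ideal. *)
Lemma squarefree_supports_closed I :
  squarefree_monomial_ideal I -> supports_closed I.
Proof.
move=> I_sqf; have iI := squarefree_is_ideal I_sqf.
case: I_sqf iI => G sqG -> iI g m Ig mg.
pose J := [set g : mpoly n K | forall m, m \in msupp g ->
  ideal_gen (@monomial K n @` G) (xset (mvars m))].
suff: J g by apply.
apply: Ig; split=> [|_ [m' Gm' <-] k]; last first.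
  rewrite msuppX inE => /eqP ->.
  suff -> : mesym1 (mvars m') = m' by apply: subset_ideal_gen; exists m'.
  apply/mnmP => i; rewrite mesym1_mem inE.
  by have := sqG _ Gm' i; case: (m' i) => [|[]].
split=> [k|a x y Jx Jy k]; first by rewrite msupp0.
move=> /msuppD_le; rewrite mem_cat => /orP[|/Jy//].
move=> /msuppM_le/allpairsP[[k1 k2] /= [_ k2x ->]].
apply: ideal_monomial_le (Jx _ k2x) => // i; rewrite !mesym1_mem !inE mnmDE.
by case: (k2 i) => // j; rewrite addnS.
Qed.

(** All squarefree monomials of [I] and not just the minimal ones, which have
    the same covers. *)
Definition edges I : {set {set 'I_n}} := [set A | `[< I (xset A) >]]%SET.

Definition blocker (F : {set {set 'I_n}}) : {set {set 'I_n}} :=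
  [set C : {set 'I_n} | [forall A in F, ~~ [disjoint A & C]]]%SET.

Lemma blockerP (F : {set {set 'I_n}}) C :
  reflect (forall A, A \in F -> exists2 i, i \in A & i \in C) (C \in blocker F).
Proof.
rewrite inE; apply: (iffP forall_inP) => FC A /FC.
  by rewrite -setI_eq0 => /set0Pn[i /setIP[iA iC]]; exists i.
by move=> [i iA iC]; rewrite -setI_eq0; apply/set0Pn; exists i; apply/setIP.
Qed.

Lemma mem_edges I A : (A \in edges I) = `[< I (xset A) >].
Proof. by rewrite inE. Qed.

Lemma prime_ideal_is_ideal P : prime_ideal P -> is_ideal P.
Proof.
by move=> [[+ _ Pax] _]; rewrite inE => P0; split=> // a x y Px Py;
  have := Pax a x y; rewrite !inE; apply.
Qed.

Lemma prime_ideal_prod P (T : finType) (D : {set T}) (f : T -> mpoly n K) :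
  prime_ideal P -> P (\prod_(t in D) f t) -> exists2 t, t \in D & P (f t).
Proof.
move=> [[_ P1 _] Pp] PD; apply/not_exists2P => nP; move: PD.
apply: (big_ind (fun x => ~ P x)) => [|x y nx ny Pxy|t tD].
- by move: P1; rewrite notin_setE.
- by have /orP[] := Pp _ _ (mem_set Pxy); rewrite inE.
- by have [|] := nP t.
Qed.

(** A prime containing a product of variables contains one of them. *)
Lemma prime_ideal_blocker I P : prime_ideal P -> I `<=` P ->
  [set i | `[< P (mpolyX K (mnm1 i)) >]]%SET \in blocker (edges I).
Proof.
move=> pP IP; apply/blockerP => A; rewrite mem_edges => /asboolP/IP.
have -> : xset A = \prod_(i in A) mpolyX K (mnm1 i).
  rewrite /monomial mpolyXE_id [RHS]big_mkcond/=; apply: eq_bigr => i _.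
  by rewrite mesym1_mem; case: (i \in A).
by move=> /(prime_ideal_prod pP)[i iA Pi]; exists i => //; rewrite inE asboolE.
Qed.

(** Membership only needs each associated prime to contain the variables of some
    cover [C], not to be generated by them: the variables in [C] already
    contribute [s] factors. *)
Lemma symbolic_pow_monomial I s m :
  (forall C, C \in blocker (edges I) -> (s <= \sum_(i in C) m i)%N) ->
  is_ideal I -> symbolic_pow I s (monomial K m).
Proof.
move=> sC iI P [pP [f PE]]; have iP := prime_ideal_is_ideal pP.
have IP : I `<=` P by move=> g Ig; rewrite PE /= mulrC; apply: idealMl.
have /sC := prime_ideal_blocker pP IP.
set C := [set i | _]%SET => {}sC.
rewrite /monomial mpolyXE_id (bigID (mem C)) /= mulrC.
apply: (@idealMl (mpoly n K) (ideal_pow P s)); first exact: ideal_pow_is_ideal.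
apply: prod_exp_ideal_pow sC => i.
by rewrite inE => /asboolP.
Qed.

Definition cweight C m : int := ((\sum_(i in C) m i)%N)%:R.

Lemma cweight_ge0 C m : 0 <= cweight C m.
Proof. exact: ler0n. Qed.

Lemma cweightD C m1 m2 : cweight C (mnm_add m1 m2) = cweight C m1 + cweight C m2.
Proof.
rewrite /cweight -natrD -big_split /=; congr (_%:R).
by apply: eq_bigr => i _; rewrite mnmDE.
Qed.

Lemma cweight_ge1 C m : (1 <= cweight C m) = [exists i in C, m i != 0%N].
Proof.
rewrite ler1n lt0n sum_nat_eq0 negb_forall; apply: eq_existsb => i.
by rewrite negb_imply.
Qed.

Definition var_ideal C : set (mpoly n K) := weight_ge (cweight C) 1.

(** Its kernel is [var_ideal C], which is therefore prime. *)
Definition kill_vars C : mpoly n K -> mpoly n K :=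
  comp_mpoly [tuple (if i \in C then 0 else mpolyX K (mnm1 i)) | i < n].

Lemma kill_varsX C m :
  kill_vars C (monomial K m) = if 1 <= cweight C m then 0 else monomial K m.
Proof.
rewrite /kill_vars comp_mpolyX; under eq_bigr do rewrite tnth_mktuple.
rewrite cweight_ge1; case: ifPn => [/exists_inP[i iC mi]|].
  by rewrite (bigD1 i)//= iC expr0n (negPf mi) mul0r.
rewrite negb_exists_in => /forall_inP mC; rewrite /monomial mpolyXE_id.
apply: eq_bigr => i _; case: ifPn => // /mC/negPn/eqP ->.
by rewrite !expr0.
Qed.

Lemma mcoeff_kill_vars C g m :
  mcoeff m (kill_vars C g) = if 1 <= cweight C m then 0 else mcoeff m g.
Proof.
rewrite /kill_vars comp_mpolyEX raddf_sum/=.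
under eq_bigr do rewrite mcoeffZ -/(kill_vars _ _) -/(monomial K _) kill_varsX.
case: (boolP (m \in msupp g)) => mg; last first.
  rewrite [mcoeff m g]memN_msupp_eq0// if_same big_seq big1// => k kg.
  case: ifP => _; rewrite ?mcoeff0 ?mulr0// mcoeffX.
  by case: eqP kg mg => [->->|]; rewrite ?mulr0.
rewrite (bigD1_seq m) ?msupp_uniq//= big1 ?addr0 => [|k km].
  by case: ifP => _; rewrite ?mcoeff0 ?mulr0// mcoeffX eqxx mulr1.
case: ifP => _; rewrite ?mcoeff0 ?mulr0// mcoeffX.
by rewrite (negPf km) mulr0.
Qed.

Lemma var_idealP C g : var_ideal C g <-> kill_vars C g = 0.
Proof.
split=> [gC|g0 m].
  apply/mpolyP => m; rewrite mcoeff_kill_vars mcoeff0; case: ifPn => // mC.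
  by apply: memN_msupp_eq0; apply: contra mC; apply: gC.
have := mcoeff_kill_vars C g m; rewrite g0 mcoeff0 mcoeff_msupp.
by case: ifP => // _ <-; rewrite eqxx.
Qed.

Lemma var_ideal_prime C : prime_ideal (var_ideal C).
Proof.
have [V0 Vax] := @weight_ge_is_ideal K n _ _ (cweightD C) (cweight_ge0 C) 1.
split; first split.
- exact/mem_set.
- rewrite notin_setE => /(_ mnm0); rewrite msupp1 inE eqxx cweight_ge1.
  by move=> /(_ isT)/exists_inP[i _]; rewrite mnm0E.
- by move=> a x y; rewrite !inE; apply: Vax.
- move=> x y; rewrite inE => /var_idealP/eqP.
  by rewrite /kill_vars rmorphM mulf_eq0 => /orP[]/eqP/var_idealP/mem_set ->//;
    rewrite orbT.
Qed.

(** The annihilated class is that of the product of the variables outside [C]. If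
    [i] is in [C], minimality gives an edge meeting [C] only in [i], and this
    edge divides the product times the variable [i]. Conversely, if a monomial
    times the product lies in [I], its variables form an edge, which meets [C]
    in a variable that the product lacks. *)
Lemma var_ideal_Ass I C : is_ideal I -> supports_closed I ->
  minset [in blocker (edges I)] C -> Ass I (var_ideal C).
Proof.
move=> iI sI /minsetP[CE Cmin]; split; first exact: var_ideal_prime.
exists (xset (~: C)%SET); apply/seteqP; split=> [g gC|g /= Ig m mg].
  rewrite /= mulrC; rewrite (mpolyE g) mulr_sumr.
  apply: ideal_sum_seq => // m /gC; rewrite cweight_ge1 => /exists_inP[i iC mi].
  have : (C :\ i)%SET \notin blocker (edges I).
    apply/negP => /Cmin/(_ (subD1set _ _)) /setP/(_ i).
    by rewrite iC !inE eqxx.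
  rewrite inE => /forall_inPn[A]; rewrite negbK => AE AC.
  rewrite -scalerAr -mul_mpolyC /monomial -mpolyXD; apply: idealMl => //.
  move: AE; rewrite mem_edges => /asboolP; apply: ideal_monomial_le => // j.
  rewrite mnmDE !mesym1_mem inE; case: (boolP (j \in A)) => // jA.
  have := disjointFr AC jA; rewrite !inE; case: (j \in C) => //=.
  by rewrite andbT => /negbFE/eqP ->; rewrite lt0n.
have mC : mnm_add (mesym1 (~: C)%SET) m \in msupp (g * (xset (~: C)%SET)).
  by rewrite mcoeff_msupp /monomial mcoeffMX -mcoeff_msupp.
have := sI _ _ Ig mC => /asboolP; rewrite -mem_edges.
move: CE => /blockerP CE /CE[i]; rewrite inE mnmDE mesym1_mem inE => + iC.
by rewrite iC cweight_ge1 => mi; apply/exists_inP; exists i.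
Qed.

Lemma symbolic_pow_supp I s g m C : is_ideal I -> supports_closed I ->
  symbolic_pow I s g -> m \in msupp g -> C \in blocker (edges I) ->
  (s <= \sum_(i in C) m i)%N.
Proof.
move=> iI sI gs mg CE.
have [C' C'min sC] := minset_exists (P := [in blocker (edges I)]) CE.
have := gs _ (var_ideal_Ass iI sI C'min).
move=> /(@ideal_pow_weight_ge K n _ _ (cweightD C') (cweight_ge0 C') _ 1 s).
move=> /(_ (fun _ => id)) /(_ _ mg); rewrite ler_nat => /leq_trans; apply.
rewrite [leqRHS](big_setID C')/= (finset.setIidPr sC).
exact: leq_addr.
Qed.

Lemma ideal_pow_packing I k (c : {set 'I_n} -> nat) m :
  (k <= \sum_(A in edges I) c A)%N ->
  (forall i, \sum_(A in edges I | i \in A) c A <= m i)%N ->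
  ideal_pow I k (monomial K m).
Proof.
move=> kc cm.
have : ideal_pow I k (\prod_(A in edges I) (xset A) ^+ c A).
  by apply: prod_exp_ideal_pow kc => A; rewrite mem_edges => /asboolP.
rewrite /monomial mprodXnE; apply: ideal_monomial_le => [|i].
  exact: ideal_pow_is_ideal.
rewrite mnm_sumE (leq_trans _ (cm i))// big_mkcondr/= leq_sum// => A _.
by rewrite mulmnE mesym1_mem; case: (i \in A); rewrite ?mul1n ?mul0n.
Qed.

End Monomials.

(** * Linear inequalities *)

Section Farkas.
Variables (R : realFieldType) (V : lmodType R).

Lemma scalar_shift (f : V -> R) a x y : scalar f -> f (x + a *: y) = f x + a * f y.
Proof. by move=> lf; rewrite addrC lf addrC. Qed.

Lemma scalar0 (f : V -> R) : scalar f -> f 0 = 0.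
Proof.
by move=> /(scalar_shift (-1) 0 0); rewrite scaler0 addr0 mulN1r subrr.
Qed.

(** Induction on the number of inequalities. If the first one is essential, there
    is [y] violating [0 <= b y], and hence [0 <= f t0 y], but no other
    inequality. Projecting along [y] onto the kernel of [f t0] removes the first
    inequality; the induction hypothesis for the projected functionals gives
    all coefficients but the one of [f t0], and the signs at [y] make the latter
    nonnegative. *)
Lemma farkas (T : eqType) (s : seq T) (f : T -> V -> R) (b : V -> R) :
    uniq s -> (forall t, scalar (f t)) -> scalar b ->
    (forall x, {in s, forall t, 0 <= f t x} -> 0 <= b x) ->
  exists2 l : T -> R, (forall t, 0 <= l t) &
    forall x, b x = \sum_(t <- s) l t * f t x.
Proof.
elim: s f b => [|t0 s IH] f b us lf lb fb.
  have b0 x : 0 <= b x by apply: fb => t; rewrite in_nil.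
  exists (fun=> 0) => // x; rewrite big_nil; apply/eqP; rewrite eq_le b0 andbT.
  have := b0 (0 + (-1) *: x).
  by rewrite scalar_shift// scalar0// add0r mulN1r oppr_ge0.
move: us => /= /andP[t0s us].
have [fb'|] := pselect (forall x, {in s, forall t, 0 <= f t x} -> 0 <= b x).
  have [l l0 bE] := IH f b us lf lb fb'.
  exists (fun t => if t == t0 then 0 else l t) => [t|x].
    by case: ifP.
  rewrite big_cons eqxx mul0r add0r bE; apply: eq_big_seq => t ts.
  by case: eqP ts t0s => // -> ->.
move=> /existsNP[y /not_implyP[sy /negP]]; rewrite -ltNge => by0.
have ft0y : f t0 y < 0.
  rewrite ltNge; apply/negP => ft0y; move: by0; rewrite ltNge fb// => t.
  by rewrite inE => /orP[/eqP->//|/sy].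
pose p := - (f t0 y)^-1.
have p0 : 0 <= p by rewrite oppr_ge0 invr_le0 ltW.
have pE : p * f t0 y = -1 by rewrite mulNr mulVf// lt_eqF.
(* [x + p * f t0 x *: y] is the projection of [x] on the kernel of [f t0]. *)
pose F (g : V -> R) x := g (x + (p * f t0 x) *: y).
have F_scalar g : scalar g -> scalar (F g).
  move=> lg a x z; rewrite /F !scalar_shift// lg (lf t0).
  by rewrite !mulrDr !mulrDl !mulrA (mulrC p a) addrACA.
have [||x Fx|l l0 bE] := IH (fun t => F (f t)) (F b) us.
- by move=> t; apply: F_scalar.
- exact: F_scalar.
- apply: fb => t; rewrite inE => /orP[/eqP->|/Fx//].
  by rewrite scalar_shift// mulrAC pE mulN1r subrr.
(* The coefficient of [f t0] collects what the projection subtracted. *)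
pose c := p * (\sum_(t <- s) l t * f t y - b y).
exists (fun t => if t == t0 then c else l t) => [t|x].
  case: ifP => // _; rewrite mulr_ge0// subr_ge0.
  apply: le_trans (ltW by0) _; rewrite big_seq sumr_ge0// => t' t's.
  by rewrite mulr_ge0// sy.
have := bE x; rewrite /F/= scalar_shift// => /(canRL (addrK _)) ->.
under eq_bigr do rewrite scalar_shift// mulrDr mulrCA.
rewrite big_split/= -mulr_sumr -addrA -mulrBr big_cons eqxx addrC; congr (_ + _).
  by rewrite /c mulrAC.
apply: eq_big_seq => t ts; case: eqP => // tt0.
by move: ts t0s; rewrite tt0 => ->.
Qed.

End Farkas.

(** * Covering polyhedra *)

Section CoverPolyhedron.
Variables (R : realType) (n : nat).
Implicit Types (F G : {set {set 'I_n}}) (A : {set 'I_n}) (x w : 'rV[R]_n).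

Definition cover_poly F : set 'rV[R]_n :=
  [set x | (forall i, 0 <= x 0 i) /\
           (forall A, A \in F -> 1 <= \sum_(i in A) x 0 i)].

Definition pairing w x : R := \sum_i w 0 i * x 0 i.

Lemma ler_pairing w w' x x' :
  (forall i, 0 <= w 0 i) -> (forall i, 0 <= x 0 i) ->
  (forall i, w 0 i <= w' 0 i) -> (forall i, x 0 i <= x' 0 i) ->
  pairing w x <= pairing w' x'.
Proof. by move=> w0 x0 ww xx; apply: ler_sum => i _; apply: ler_pM. Qed.

Definition unit_cube : set 'rV[R]_n := [set x | forall i, x 0 i \in `[0, 1]].

Definition truncate x : 'rV[R]_n := \row_i Num.min (x 0 i) 1.

Lemma truncate_le x i : truncate x 0 i <= x 0 i.
Proof. by rewrite mxE ge_min lexx. Qed.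

Lemma truncate_cover_poly F x : cover_poly F x ->
  (cover_poly F `&` unit_cube) (truncate x).
Proof.
move=> [x0 xF]; have t0 i : 0 <= truncate x 0 i by rewrite mxE le_min x0 ler01.
split; first split=> // A AF; last first.
  by move=> i; rewrite in_itv/= t0 mxE ge_min lexx orbT.
have [[i iA xi]|nA] := pselect (exists2 i, i \in A & 1 <= x 0 i).
  rewrite (bigD1 i)//= -[X in X <= _]addr0 lerD ?sumr_ge0//.
  by rewrite mxE le_min xi lexx.
rewrite (le_trans (xF _ AF))// ler_sum// => i iA; rewrite mxE le_min lexx/=.
by rewrite leNgt; apply/negP => /ltW xi; apply: nA; exists i.
Qed.

Lemma sum_continuous (T : topologicalType) (P : pred 'I_n) (f : 'I_n -> T -> R) :
  (forall i, P i -> continuous (f i)) -> continuous (fun t => \sum_(i | P i) f i t).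
Proof. by move=> cf; apply: continuous_big => //; exact: add_continuous. Qed.

Lemma cover_poly_cube_compact F : compact (cover_poly F `&` unit_cube).
Proof.
have -> : cover_poly F `&` unit_cube =
  unit_cube `&` \bigcap_(A in [set A | A \in F])
    ((fun x => \sum_(i in A) x 0 i) @^-1` [set y | 1 <= y]).
  apply/seteqP; split=> x [] => [[x0 xF] x1|x1 xF].
    by split=> // A /= /xF.
  split=> //; split=> [i|A /xF//]; have := x1 i.
  by rewrite in_itv => /andP[].
apply: compact_closedI.
  apply: (@rV_compact R n (fun=> `[0, 1]%classic)) => _; exact: segment_compact.
apply: closed_bigI => A _; apply: preimage_closed; last exact: closed_ge.
move=> x _; apply: sum_continuous => i _; exact: coord_continuous.
Qed.

(** Truncating at 1 does not leave the polyhedra, so the minimum of the pairing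
    over the unbounded product is that over a compact one. *)
Lemma pairing_min_attained F G :
  cover_poly F !=set0 -> cover_poly G !=set0 ->
  exists w x, [/\ (cover_poly F `&` unit_cube) w, (cover_poly G `&` unit_cube) x &
    forall w' x', cover_poly F w' -> cover_poly G x' ->
      pairing w x <= pairing w' x'].
Proof.
move=> [w0 /truncate_cover_poly Fw0] [x0 /truncate_cover_poly Gx0].
pose D := (cover_poly F `&` unit_cube) `*` (cover_poly G `&` unit_cube).
have cD : compact D by apply: compact_setX; apply: cover_poly_cube_compact.
have D0 : D !=set0 by exists (truncate w0, truncate x0).
have cf : {within D, continuous (fun p : 'rV[R]_n * 'rV[R]_n => pairing p.1 p.2)}.
  apply: continuous_subspaceT; apply: sum_continuous => i _ p.
  apply: continuousM; apply: (@continuous_comp _ _ _ _ (fun M : 'rV[R]_n => M 0 i)).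
  - exact: cvg_fst.
  - exact: coord_continuous.
  - exact: cvg_snd.
  - exact: coord_continuous.
have [[w x] + min] := compact_EVT_min D0 cD cf.
rewrite inE => -[Fw Gx]; exists w, x; split=> // w' x' Fw' Gx'.
have /min/le_trans : (truncate w', truncate x') \in D.
  by apply/mem_set; split; apply: truncate_cover_poly.
apply; have [[tw _] _] := truncate_cover_poly Fw'.
have [[tx _] _] := truncate_cover_poly Gx'.
by apply: ler_pairing => // i; apply: truncate_le.
Qed.

(** Strong duality for the fractional covering problem: the inequality
    [mu * z <= pairing w x] follows from [0 <= w 0 i] and from
    [z <= \sum_(i in A) w 0 i] for [A] in [F], where the extra variable [z]
    makes the system homogeneous. The multipliers of the inequalities indexed
    by [F] form the packing. *)
Lemma fractional_packing F x mu :
  (forall i, 0 <= x 0 i) -> 0 <= mu ->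
  (forall w, cover_poly F w -> mu <= pairing w x) ->
  exists c : {set 'I_n} -> R, [/\ forall A, 0 <= c A,
    \sum_(A in F) c A = mu &
    forall i, \sum_(A in F | i \in A) c A <= x 0 i].
Proof.
move=> x0 mu0 Fmu.
pose f (t : 'I_n + {set 'I_n}) (p : 'rV[R]_n * R^o) : R :=
  match t with inl i => p.1 0 i | inr A => \sum_(i in A) p.1 0 i - p.2 end.
pose b (p : 'rV[R]_n * R^o) : R := pairing p.1 x - mu * p.2.
pose s : seq ('I_n + {set 'I_n}) := map inl (index_enum 'I_n) ++ map inr (enum F).
have us : uniq s.
  rewrite cat_uniq; apply/and3P; split.
  - by rewrite map_inj_uniq ?index_enum_uniq// => ? ? [].
  - by apply/hasPn => _ /mapP[A _ ->]; apply/negP => /mapP[].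
  - by rewrite map_inj_uniq ?enum_uniq// => ? ? [].
have lf t : scalar (f t).
  move=> a p q; case: t => [i|A] /=; first by rewrite !mxE.
  rewrite mulrBr mulr_sumr addrACA -opprD -big_split/=; congr (_ - _).
  by apply: eq_bigr => i _; rewrite !mxE.
have lb : scalar b.
  move=> a p q; rewrite /b /pairing/= mulrBr mulr_sumr addrACA -opprD -big_split/=.
  congr (_ - _); last by rewrite mulrDr mulrCA.
  by apply: eq_bigr => i _; rewrite !mxE mulrDl mulrA.
have fb p : {in s, forall t, 0 <= f t p} -> 0 <= b p.
  move=> sp; have p0 i : 0 <= p.1 0 i.
    by apply: (sp (inl i)); rewrite mem_cat map_f ?mem_index_enum.
  have pF A : A \in F -> p.2 <= \sum_(i in A) p.1 0 i.
    move=> AF; rewrite -subr_ge0; apply: (sp (inr A)).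
    by rewrite mem_cat orbC map_f ?mem_enum.
  rewrite subr_ge0; have [z0|z0] := leP p.2 0.
    rewrite (@le_trans _ _ 0) ?mulr_ge0_le0//.
    by apply: sumr_ge0 => i _; apply: mulr_ge0.
  have : cover_poly F (p.2^-1 *: p.1).
    split=> [i|A AF]; first by rewrite mxE mulr_ge0// invr_ge0 ltW.
    under eq_bigr do rewrite mxE.
    by rewrite -mulr_sumr mulrC ler_pdivlMr// mul1r pF.
  move=> /Fmu; rewrite /pairing; under eq_bigr do rewrite mxE -mulrA.
  by rewrite -mulr_sumr mulrC ler_pdivlMr.
have [l l0 bE] := farkas us lf lb fb.
have {}bE p : b p = \sum_i l (inl i) * p.1 0 i +
    \sum_(A in F) l (inr A) * (\sum_(i in A) p.1 0 i - p.2).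
  by rewrite bE big_cat !big_map big_enum.
exists (fun A => l (inr A)); split=> // [|j].
  (* The coefficients of [z] give the total weight. *)
  have := bE (0, 1); rewrite /b /pairing /= big1 => [|i _]; last first.
    by rewrite mxE mul0r.
  rewrite [X in _ = X + _]big1 => [|i _]; last by rewrite mxE mulr0.
  rewrite !add0r mulr1 => /eqP; rewrite eqr_oppLR => /eqP ->.
  rewrite -sumrN; apply: eq_bigr => A _; rewrite big1 => [|i _]; last by rewrite mxE.
  by rewrite sub0r mulrN1 opprK.
(* The coefficients of [w 0 j] give the bound at [j]. *)
have := bE (delta_mx 0 j, 0); rewrite /b /pairing /= mulr0 subr0.
rewrite (bigD1 j)//= mxE !eqxx mul1r big1 ?addr0 => [|i ij]; last first.
  by rewrite mxE (negPf ij) andbF mul0r.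
move=> ->; rewrite ler_wpDl//.
  by apply: sumr_ge0 => i _; rewrite mulr_ge0// mxE ler0n.
rewrite big_mkcondr/= ler_sum// => A _; rewrite subr0.
case: ifP => jA; last by rewrite mulr_ge0// sumr_ge0// => i _; rewrite mxE ler0n.
rewrite ler_peMr// (bigD1 j)//= mxE !eqxx lerDl.
by rewrite sumr_ge0// => i _; rewrite mxE ler0n.
Qed.

End CoverPolyhedron.

Arguments cover_poly R [n] F.

(** * Skew valuations *)

Lemma ratio_between (R : realType) (y a : R) : 0 <= y -> y < a ->
  exists s r : nat, [/\ (0 < s)%N, (0 < r)%N, y < s%:R / r%:R & s%:R / r%:R < a].
Proof.
move=> y0 ya; pose b := (y + a) / 2.
have [yb ba] : y < b /\ b < a by rewrite !midf_lt.
pose r := (Num.truncn (b - y)^-1).+1; pose s := Num.truncn (b * r%:R).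
have r0 : 0 < r%:R :> R by rewrite ltr0n.
have sr : y < s%:R / r%:R.
  rewrite ltr_pdivlMr// -(ltrD2r 1) natr1 (le_lt_trans _ (truncnS_gt _))//.
  rewrite addrC -lerBrDr -mulrBl mulrC -ler_pdivrMr ?subr_gt0// mul1r.
  by rewrite ltW// truncnS_gt.
exists s, r; split=> //; last first.
  rewrite (le_lt_trans _ ba)// ler_pdivrMr// truncn_le mulr_ge0 ?ltW//.
  exact: le_lt_trans yb.
by rewrite lt0n; apply: contraTneq sr => ->; rewrite mul0r -leNgt.
Qed.

Section SkewValuations.
Variables (R : realType) (K : fieldType) (n : nat).
Implicit Types (v : {scalar 'rV[R]_n}) (I J : set (mpoly n K)) (x y w : 'rV[R]_n).
Local Notation expv := (exponent_vector R).

Lemma skew_le v x y : skew_valuation v ->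
  (forall i, x 0 i <= y 0 i) -> v x <= v y.
Proof.
move=> v0 xy; rewrite -subr_ge0 -linearB v0// => i.
by rewrite !mxE subr_ge0.
Qed.

Lemma expvD (m1 m2 : multinom n) : expv (mnm_add m1 m2) = expv m1 + expv m2.
Proof. by apply/rowP => i; rewrite !mxE mnmDE natrD. Qed.

Lemma expv_ge0 (m : multinom n) i : 0 <= expv m 0 i.
Proof. by rewrite mxE ler0n. Qed.

Lemma skew_expv_ge0 v (m : multinom n) : skew_valuation v -> 0 <= v (expv m).
Proof. by apply=> i; apply: expv_ge0. Qed.

Lemma val_ideal_le v J m : skew_valuation v -> J (monomial K m) ->
  val_ideal v J <= v (expv m).
Proof.
move=> v0 Jm; apply: ge_inf; last by exists m.
by exists 0 => _ [m' _ <-]; apply: skew_expv_ge0.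
Qed.

Lemma le_val_ideal v J c : (exists m, J (monomial K m)) ->
  (forall m, J (monomial K m) -> c <= v (expv m)) -> c <= val_ideal v J.
Proof.
move=> [m Jm] Jc; apply: lb_le_inf; first by exists (v (expv m)), m.
by move=> _ [m' Jm' <-]; apply: Jc.
Qed.

Lemma pairing_is_scalar w : scalar (@pairing R n w).
Proof.
move=> a x y; rewrite /pairing mulr_sumr -big_split/=; apply: eq_bigr => i _.
by rewrite !mxE mulrDr mulrCA.
Qed.

HB.instance Definition _ w := GRing.isLinear.Build R 'rV[R]_n R _
  (@pairing R n w) (pairing_is_scalar w).

Lemma pairing_skew w : (forall i, 0 <= w 0 i) -> skew_valuation (pairing w).
Proof. by move=> w0 x x0; apply: sumr_ge0 => i _; apply: mulr_ge0. Qed.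

Section FixedIdeal.
Variable I : set (mpoly n K).
Hypotheses (iI : is_ideal I) (sI : supports_closed I).
Hypothesis I_edge : exists A, A \in edges I.
Hypothesis I_set0 : finset.set0 \notin edges I.

Definition sym_poly : set 'rV[R]_n := cover_poly R (blocker (edges I)).

Lemma ones_in_cover_poly (F : {set {set 'I_n}}) :
  finset.set0 \notin F -> cover_poly R F (\row_i 1).
Proof.
move=> F0; split=> [i|A AF]; first by rewrite mxE.
have /set0Pn[i iA] : A != finset.set0 by apply: contraNneq F0 => <-.
by rewrite (bigD1 i)//= mxE lerDl sumr_ge0// => j _; rewrite mxE.
Qed.

Lemma sym_poly_nonempty : sym_poly !=set0.
Proof.
exists (\row_i 1); apply: ones_in_cover_poly; case: I_edge => A AE.
by apply/negP => /blockerP/(_ _ AE)[i _]; rewrite inE.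
Qed.

Lemma edges_val v A : skew_valuation v -> A \in edges I ->
  val_ideal v I <= v (expv (mesym1 A)).
Proof. by move=> v0; rewrite mem_edges => /asboolP; apply: val_ideal_le. Qed.

Lemma sym_poly_of_symbolic s g m : (0 < s)%N -> symbolic_pow I s g ->
  m \in msupp g -> sym_poly (s%:R^-1 *: expv m).
Proof.
move=> s0 gs mg; split=> [i|C CE].
  by rewrite mxE mulr_ge0 ?invr_ge0 ?expv_ge0.
under eq_bigr do rewrite mxE.
rewrite -mulr_sumr mulrC ler_pdivlMr ?ltr0n// mul1r.
under eq_bigr do rewrite mxE.
by rewrite -natr_sum ler_nat; apply: symbolic_pow_supp gs mg CE.
Qed.

(** Rounding up the multiple [s *: x]. *)
Lemma symbolic_of_sym_poly s x : sym_poly x -> exists2 m,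
  symbolic_pow I s (monomial K m) & forall i, (m i)%:R <= s%:R * x 0 i + 1.
Proof.
move=> [x0 xC]; pose m := Multinom [tuple (Num.truncn (s%:R * x 0 i)).+1 | i < n].
have mE i : m i = (Num.truncn (s%:R * x 0 i)).+1 by apply: mnmE.
have sx0 i : 0 <= s%:R * x 0 i by rewrite mulr_ge0.
exists m => [|i]; last by rewrite mE -natr1 lerD2r truncn_le.
apply: symbolic_pow_monomial => // C CE; rewrite -(ler_nat R) natr_sum.
rewrite -[X in X <= _]mulr1 (@le_trans _ _ (s%:R * \sum_(i in C) x 0 i))//.
  by rewrite ler_wpM2l// xC.
by rewrite mulr_sumr ler_sum// => i _; rewrite mE ltW// truncnS_gt.
Qed.

Lemma val_symbolic_of_sym_poly v s x : skew_valuation v -> sym_poly x ->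
  exists2 m, symbolic_pow I s (monomial K m) &
    v (expv m) <= s%:R * v x + v (\row_i 1).
Proof.
move=> v0 /(symbolic_of_sym_poly s)[m ms mx]; exists m => //.
by rewrite -linearZ -linearD skew_le// => i; rewrite !mxE.
Qed.

Definition inf_sym_poly v : R := inf (v @` sym_poly).

Lemma inf_sym_poly_le v x : skew_valuation v -> sym_poly x -> inf_sym_poly v <= v x.
Proof.
move=> v0 Sx; apply: ge_inf; last by exists x.
by exists 0 => _ [y [y0 _] <-]; apply: v0.
Qed.

Lemma le_inf_sym_poly v c : (forall x, sym_poly x -> c <= v x) -> c <= inf_sym_poly v.
Proof.
move=> cS; apply: lb_le_inf => [|_ [x Sx <-]]; last exact: cS.
by have [x Sx] := sym_poly_nonempty; exists (v x), x.
Qed.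

(** Dividing the exponents of the [s]-th symbolic power by [s] gives points of the
    polyhedron, and each of its points is obtained up to an error of order
    [1 / s]. *)
Lemma skew_waldschmidtE v : skew_valuation v ->
  skew_waldschmidt v I = inf_sym_poly v.
Proof.
move=> v0; pose u s := val_ideal v (symbolic_pow I s) / s%:R.
have u_ge s : (0 < s)%N -> inf_sym_poly v <= u s.
  move=> s0; rewrite ler_pdivlMr ?ltr0n//; apply: le_val_ideal.
    by have [x /(symbolic_of_sym_poly s)[m ms _]] := sym_poly_nonempty; exists m.
  move=> m ms; rewrite mulrC -ler_pdivlMl ?ltr0n//.
  rewrite -[_ * v _]/(_ *: (v _ : R^o)) -linearZ inf_sym_poly_le//.
  by apply: sym_poly_of_symbolic ms _; rewrite ?msuppX ?inE.
have u_le s : (0 < s)%N -> u s <= inf_sym_poly v + v (\row_i 1) / s%:R.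
  move=> s0; rewrite -lerBlDr -mulrBl; apply: le_inf_sym_poly => x Sx.
  rewrite ler_pdivrMr ?ltr0n// lerBlDr mulrC.
  have [m ms] := val_symbolic_of_sym_poly s v0 Sx.
  by apply: le_trans; apply: val_ideal_le.
apply: cvg_lim => //; rewrite -/u -(cvg_shiftS u).
apply: (@squeeze_cvgr _ _ _ _ (fun=> inf_sym_poly v)
  (fun s => inf_sym_poly v + v (\row_i 1) * harmonic s)).
- by near=> s; rewrite u_ge//= u_le.
- exact: cvg_cst.
- rewrite -[X in _ --> X]addr0; apply: cvgD; first exact: cvg_cst.
  by rewrite -(mulr0 (v (\row_i 1))); apply: cvgMr; exact: cvg_harmonic.
Unshelve. all: by end_near. Qed.

(** A point of the symbolic polyhedron has all its coordinates at least
    [1 / (n + 1)] on some edge: otherwise the small coordinates would form a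
    cover of total weight less than 1. *)
Lemma val_ideal_le_sym_poly v x : skew_valuation v -> sym_poly x ->
  val_ideal v I <= n.+1%:R * v x.
Proof.
move=> v0 [x0 xC]; pose D := [set i | x 0 i < n.+1%:R^-1]%SET.
have : D \notin blocker (edges I).
  apply/negP => /xC; apply/negP; rewrite -ltNge.
  rewrite (@le_lt_trans _ _ (\sum_(i in D) n.+1%:R^-1))//.
    by apply: ler_sum => i; rewrite inE => /ltW.
  rewrite sumr_const -[X in X < _]mulr_natl ltr_pdivrMr ?ltr0n// mul1r ltr_nat ltnS.
  by rewrite -[X in (_ <= X)%N]card_ord max_card.
rewrite inE => /forall_inPn[A AE]; rewrite negbK => AD.
rewrite (le_trans (edges_val v0 AE))//.
rewrite -[_ * v _]/(_ *: (v _ : R^o)) -linearZ skew_le// => i.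
rewrite !mxE mesym1_mem; case: (boolP (i \in A)) => iA; last by rewrite mulr_ge0.
have := disjointFr AD iA; rewrite inE => /negbT; rewrite -leNgt => xi.
by rewrite mulrC -ler_pdivrMr ?ltr0n// mul1r.
Qed.

Lemma skew_waldschmidt_gt0 v : skew_valuation v -> supported v I ->
  0 < skew_waldschmidt v I.
Proof.
move=> v0 vI; rewrite skew_waldschmidtE// (@lt_le_trans _ _ (val_ideal v I / n.+1%:R))//.
  by rewrite divr_gt0// ltr0n.
apply: le_inf_sym_poly => x Sx; rewrite ler_pdivrMr ?ltr0n// mulrC.
exact: val_ideal_le_sym_poly.
Qed.

Lemma val_ideal_pow v k m : skew_valuation v -> ideal_pow I k (monomial K m) ->
  val_ideal v I *+ k <= v (expv m).
Proof.
move=> v0.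
have vD m1 m2 : v (expv (mnm_add m1 m2)) = v (expv m1) + v (expv m2).
  by rewrite expvD linearD.
have v_ge0 m' : 0 <= v (expv m') by apply: skew_expv_ge0.
move=> /(ideal_pow_weight_ge vD v_ge0 (c := val_ideal v I)).
apply; last by rewrite msuppX inE.
move=> g Ig m' m'g; apply: (le_trans (edges_val v0 (A := mvars m') _)).
  by rewrite mem_edges; apply/asboolP/(sI Ig).
rewrite skew_le// => i; rewrite !mxE mesym1_mem inE ler_nat.
by case: (m' i).
Qed.

(** A point of the symbolic polyhedron nearly attaining the skew Waldschmidt
    constant gives, after scaling by [s * t] and rounding up, a monomial whose
    value is too small for the ordinary power: the gap grows linearly in [t],
    while rounding up costs at most the value of the all-ones vector. *)
Lemma skew_obstruction v s r : skew_valuation v -> (0 < s)%N ->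
  s%:R * skew_waldschmidt v I < r%:R * val_ideal v I ->
  \forall t \near \oo, ~ (symbolic_pow I (s * t) `<=` ideal_pow I (r * t)).
Proof.
move=> v0 s0; rewrite skew_waldschmidtE// mulrC -ltr_pdivlMr ?ltr0n// => svr.
have vS : (v @` sym_poly) !=set0.
  by have [x Sx] := sym_poly_nonempty; exists (v x), x.
have [_ [x Sx <-]] := inf_lt vS svr.
rewrite ltr_pdivlMr ?ltr0n// mulrC -subr_gt0; set d := _ - _ => d0.
exists (Num.truncn (v (\row_i 1) / d)).+1 => // t /= Nt sub.
have [m /sub ms] := val_symbolic_of_sym_poly (s * t) v0 Sx.
apply/negP; rewrite -ltNge (lt_le_trans _ (val_ideal_pow v0 ms))//.
rewrite -[X in _ < X]mulr_natr -ltrBrDl.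
have -> : val_ideal v I * (r * t)%:R - (s * t)%:R * v x = d * t%:R.
  rewrite mulrBl !natrM; congr (_ - _); last by rewrite mulrAC.
  by rewrite mulrCA mulrA.
rewrite -ltr_pdivrMl// mulrC.
by rewrite (lt_le_trans (truncnS_gt _))// ler_nat.
Qed.

(** Conversely, when every weight that is at least 1 on all edges is at least
    [mu] on the symbolic polyhedron, duality writes each of its points as a
    fractional packing of edges of total weight [mu]; rounding down loses less
    than one per edge, which is negligible for large [t]. *)
Lemma symbolic_sub_ideal_pow mu s r : 0 <= mu -> (0 < s)%N ->
  (forall w x, cover_poly R (edges I) w -> sym_poly x -> mu <= pairing w x) ->
  r%:R < s%:R * mu ->
  \forall t \near \oo, symbolic_pow I (s * t) `<=` ideal_pow I (r * t).
Proof.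
move=> mu0 s0 muP; rewrite -subr_gt0; set d := _ - _ => d0.
pose N := #|edges I|.
exists (Num.truncn (N%:R / d)).+1 => // t /= Nt g gst.
have t0 : (0 < t)%N by apply: leq_trans Nt.
have st0 : (0 < s * t)%N by rewrite muln_gt0 s0.
have NR : N%:R <= d * t%:R.
  rewrite mulrC -ler_pdivrMr//; apply: ltW.
  by rewrite (lt_le_trans (truncnS_gt _))// ler_nat.
apply: ideal_supp_monomial => [|m mg]; first exact: ideal_pow_is_ideal.
have Sm := sym_poly_of_symbolic st0 gst mg.
have [c [c0 cmu cm]] := fractional_packing Sm.1 mu0 (fun w Ew => muP w _ Ew Sm).
have stc0 A : 0 <= (s * t)%:R * c A by rewrite mulr_ge0.
apply: (ideal_pow_packing (c := fun A => Num.truncn ((s * t)%:R * c A))) => [|i].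
  rewrite -(ler_nat R) natr_sum.
  apply: (@le_trans _ _ (\sum_(A in edges I) ((s * t)%:R * c A - 1))).
    rewrite sumrB -mulr_sumr cmu sumr_const lerBrDl -lerBrDr.
    by rewrite !natrM mulrAC -mulrBl.
  by apply: ler_sum => A _; rewrite lerBlDr natr1 ltW// truncnS_gt.
rewrite -(ler_nat R) natr_sum.
apply: (@le_trans _ _ (\sum_(A in edges I | i \in A) (s * t)%:R * c A)).
  by apply: ler_sum => A _; rewrite truncn_le.
rewrite -mulr_sumr -ler_pdivlMl ?ltr0n// (le_trans (cm i))//.
by rewrite !mxE.
Qed.

Lemma val_ideal_pairing_ge1 w : cover_poly R (edges I) w ->
  1 <= val_ideal (pairing w) I.
Proof.
move=> [w0 wE]; apply: le_val_ideal.
  by case: I_edge => A; rewrite mem_edges => /asboolP; exists (mesym1 A).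
move=> m Im; apply: (le_trans (wE (mvars m) _)).
  by rewrite mem_edges; apply/asboolP/(sI Im); rewrite msuppX inE.
rewrite /pairing/= big_mkcond/= ler_sum// => i _; rewrite mxE inE.
by case: (m i) => [|j]; rewrite ?mulr0//= ler_peMr// ler1n.
Qed.

Lemma asymptotic_resurgence_ge v : skew_valuation v -> supported v I ->
  ((skew_resurgence v I)%:E <= asymptotic_resurgence R I)%E.
Proof.
move=> v0 vI; have th0 := skew_waldschmidt_gt0 v0 vI.
have lb s r : (0 < s)%N -> (0 < r)%N -> s%:R / r%:R < skew_resurgence v I ->
    ((s%:R / r%:R)%:E <= asymptotic_resurgence R I)%E.
  move=> s0 r0 sr; apply: ereal_sup_ubound; exists s, r; split=> //.
  apply: (skew_obstruction v0 s0).
  rewrite [X in _ < X]mulrC -ltr_pdivlMr// mulrAC -ltr_pdivrMr ?ltr0n//.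
rewrite leNgt; apply/negP => lt_va.
have [z [z0 zva asz]] : exists z : R, [/\ 0 <= z, z < skew_resurgence v I &
    (asymptotic_resurgence R I <= z%:E)%E].
  have va0 : 0 < skew_resurgence v I by rewrite divr_gt0.
  case: (asymptotic_resurgence R I) lt_va => [q||].
  - rewrite lte_fin => qva; exists (Num.max q 0).
    by rewrite le_max lexx orbT gt_max qva va0 lee_fin le_max lexx.
  - by rewrite ltNge leey.
  - by exists 0; rewrite leNye.
have [s [r [s0 r0 zsr sra]]] := ratio_between z0 zva.
by have := le_trans (lb _ _ s0 r0 sra) asz; rewrite lee_fin leNgt zsr.
Qed.

(** The valuation is a minimizer [w] of the pairing. With [mu] the least value,
    the asymptotic resurgence is at most [1 / mu] because containment holds
    beyond it, and the resurgence of [w] is at least [1 / mu] because [w] is at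
    least 1 on [I] and takes the value [mu] in the symbolic polyhedron. *)
Lemma asymptotic_resurgence_attained : exists2 v : {scalar 'rV[R]_n},
  skew_valuation v /\ supported v I &
  (asymptotic_resurgence R I <= (skew_resurgence v I)%:E)%E.
Proof.
have E0 : cover_poly R (edges I) !=set0.
  by exists (\row_i 1); apply: ones_in_cover_poly.
have [w [x [[Ew _] [Sx _] min]]] := pairing_min_attained E0 sym_poly_nonempty.
have v0 : skew_valuation (pairing w) by apply: pairing_skew; case: Ew.
have v1 := val_ideal_pairing_ge1 Ew.
have vI : supported (pairing w) I by apply: lt_le_trans v1.
exists (pairing w) => //.
have th0 := skew_waldschmidt_gt0 v0 vI.
have thmu : skew_waldschmidt (pairing w) I <= pairing w x.
  by rewrite skew_waldschmidtE// inf_sym_poly_le.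
have mu0 : 0 < pairing w x by apply: lt_le_trans thmu.
apply: ge_ereal_sup => _ [s [r [s0 r0 nsub ->]]]; rewrite lee_fin.
apply: (@le_trans _ _ (pairing w x)^-1); last first.
  rewrite /skew_resurgence ler_pdivlMr// mulrC ler_pdivrMr//.
  by rewrite (le_trans thmu)// ler_peMl// ltW.
rewrite leNgt; apply/negP => musr.
have lt_sr : r%:R < s%:R * pairing w x.
  by rewrite -ltr_pdivrMr// mulrC -ltr_pdivlMr ?ltr0n.
have sub := symbolic_sub_ideal_pow (ltW mu0) s0 min lt_sr.
by have [t []] := filter_ex (filterI nsub sub).
Qed.

End FixedIdeal.
End SkewValuations.

(** * The asymptotic resurgence is the largest skew resurgence *)

Theorem theorem2p15 (R : realType) (K : fieldType) (n : nat)
    (I : set (mpoly n K))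
    (I_sqfree : squarefree_monomial_ideal I)
    (I_nonzero : I <> [set 0])
    (I_proper : I <> setT) :
  asymptotic_resurgence R I = ereal_sup (skew_resurgences R I) /\
  skew_resurgences R I (asymptotic_resurgence R I).
Proof.
have iI := squarefree_is_ideal I_sqfree.
have sI := squarefree_supports_closed I_sqfree.
have I_edge : exists A, A \in edges I.
  apply: contrapT => nE; apply: I_nonzero; apply/seteqP; split=> g => [Ig|->].
    apply: msuppnil0; case mg: (msupp g) => [//|m l]; case: nE.
    exists (mvars m); rewrite mem_edges; apply/asboolP/(sI g) => //.
    by rewrite mg mem_head.
  exact: iI.1.
(* The empty edge is the monomial 1. *)
have I_set0 : finset.set0 \notin edges I.
  rewrite mem_edges; apply/asboolP; rewrite mesym1_set0 /monomial mpolyX0 => I1.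
  apply: I_proper; apply/seteqP; split=> // g _; rewrite -[g]mulr1.
  exact: idealMl.
have [v [v0 vI] le_v] := asymptotic_resurgence_attained R iI sI I_edge I_set0.
have vE : (skew_resurgence v I)%:E = asymptotic_resurgence R I.
  by apply/eqP; rewrite eq_le le_v asymptotic_resurgence_ge.
have in_skew : skew_resurgences R I (asymptotic_resurgence R I) by exists v.
split=> //; apply/eqP; rewrite eq_le ereal_sup_ubound//=.
apply: ge_ereal_sup => _ [w [w0 wI] <-].
exact: asymptotic_resurgence_ge.
Qed.
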